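(* Let $n\ge1$ and, for distinct points $a_1,\dots,a_n$ in the upper half-plane $\mathbb H$, let $$\mathcal S(a_1,\dots,a_n)=\prod_{k=1}^{n}(\mathrm{Im}\, a_k)^{-\frac18}\Bigl(\sum_{\sigma\in\{\pm1\}^n}\ \prod_{1\le i<j\le n}\left|\frac{a_i-a_j}{a_i-\bar a_j}\right|^{\frac{\sigma_i\sigma_j}{2}}\Bigr)^{\frac12}$$ (the formula for the spin correlations in the scaling limit of the critical Ising model in the half-plane). Then $\mathcal S$ satisfies the Belavin--Polyakov--Zamolodchikov equations: for each $i=1,\dots,n$, it is annihilated by the differential operator $$\frac{8}{3}\frac{\partial^2}{(\partial a_i)^2}+\sum_{j\ne i}\frac{2}{a_j-a_i}\frac{\partial}{\partial a_j}+\sum_{j=1}^n\frac{2}{\bar a_j-a_i}\frac{\partial}{\partial\bar a_j}-\sum_{j\neq i}\frac{1/8}{(a_j-a_i)^2}-\sum_{j=1}^n\frac{1/8}{(\bar a_j-a_i)^2}.$$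
   Context: Here $\frac{\partial}{\partial a_j}$ and $\frac{\partial}{\partial\bar a_j}$ are the Wirtinger derivatives, i.e. for $a=x+iy$, $\frac{\partial}{\partial a}=\frac12(\partial_x-i\partial_y)$ and $\frac{\partial}{\partial \bar a}=\frac12(\partial_x+i\partial_y)$. *)

(* Defs.v *)
From mathcomp Require Import all_boot all_order all_algebra.
From mathcomp Require Import all_classical all_reals all_analysis.
From mathcomp Require Import complex.

Set Implicit Arguments.
Unset Strict Implicit.
Unset Printing Implicit Defensive.

Import Order.TTheory GRing.Theory Num.Theory.
Import numFieldNormedType.Exports.

Local Open Scope classical_set_scope.
Local Open Scope ring_scope.
Local Open Scope complex_scope.

(* R[i] carries no normed-module structure over R, so a function from R to R[i]
   is differentiated componentwise. *)
Definition cderivable (R : realType) (g : R -> R[i]) (t : R) : Prop :=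
  derivable (fun s => complex.Re (g s)) t 1 /\
  derivable (fun s => complex.Im (g s)) t 1.

Definition cderive (R : realType) (g : R -> R[i]) (t : R) : R[i] :=
  derive1 (fun s => complex.Re (g s)) t +i* derive1 (fun s => complex.Im (g s)) t.

Definition slice_x (R : realType) (f : R[i] -> R[i]) (z : R[i]) : R -> R[i] :=
  fun x => f (x +i* complex.Im z).

Definition slice_y (R : realType) (f : R[i] -> R[i]) (z : R[i]) : R -> R[i] :=
  fun y => f (complex.Re z +i* y).

Definition partials_exist (R : realType) (f : R[i] -> R[i]) (z : R[i]) : Prop :=
  cderivable (slice_x f z) (complex.Re z) /\
  cderivable (slice_y f z) (complex.Im z).

Definition wirtinger (R : realType) (f : R[i] -> R[i]) (z : R[i]) : R[i] :=
  2^-1 * (cderive (slice_x f z) (complex.Re z)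
          - 'i%C * cderive (slice_y f z) (complex.Im z)).

Definition wirtinger_bar (R : realType) (f : R[i] -> R[i]) (z : R[i]) : R[i] :=
  2^-1 * (cderive (slice_x f z) (complex.Re z)
          + 'i%C * cderive (slice_y f z) (complex.Im z)).

Section SeveralVariables.
Context {R : realType} {n : nat}.
Implicit Types (F : ('I_n -> R[i]) -> R[i]) (a : 'I_n -> R[i]) (j : 'I_n).

Definition in_var F a j : R[i] -> R[i] := fun z => F (dfwith a j z).

Definition partials_exist_at j F a : Prop := partials_exist (in_var F a j) (a j).

Definition d_ j F a : R[i] := wirtinger (in_var F a j) (a j).

Definition dbar_ j F a : R[i] := wirtinger_bar (in_var F a j) (a j).

Definition bpz_operator (i : 'I_n) F a : R[i] :=
  8 / 3 * d_ i (d_ i F) a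
  + \sum_(j < n | j != i) 2 / (a j - a i) * d_ j F a
  + \sum_(j < n) 2 / ((a j)^*%C - a i) * dbar_ j F a
  - (\sum_(j < n | j != i) 8^-1 / (a j - a i) ^+ 2) * F a
  - (\sum_(j < n) 8^-1 / ((a j)^*%C - a i) ^+ 2) * F a.

(* The derivatives above are total, with an arbitrary value where the limit does
   not exist, so being annihilated includes the existence of those involved. *)
Definition bpz_annihilates (i : 'I_n) F a : Prop :=
  [/\ forall j, partials_exist_at j F a,
      partials_exist_at i (d_ i F) a &
      bpz_operator i F a = 0].

Definition spin (b : bool) : R := (-1) ^+ b.

Definition spin_correlation a : R :=
  (\prod_(k < n) complex.Im (a k) `^ (- 8^-1))
  * (\sum_(s : {ffun 'I_n -> bool})
      \prod_(i < n) \prod_(j < n | (i < j)%N)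
        Normc.normc ((a i - a j) / (a i - (a j)^*%C))
          `^ (spin (s i) * spin (s j) / 2)) `^ 2^-1.

End SeveralVariables.

(* Main.v *)
Require Import Defs.
From mathcomp Require Import all_boot all_order all_algebra.
From mathcomp Require Import all_classical all_reals all_analysis.
From mathcomp Require Import complex.
From mathcomp Require Import ring lra.

(** Put W = sum_s T_s, so that the correlation is S = W^(1/2), where T_s is the
    Coulomb gas correlation of charges s_k at a_k and -s_k at conj(a_k). Writing
    A_s for the logarithmic derivative of T_s in z = a_i, and B_s for the
    derivative of A_s, the BPZ equation for S is, up to a constant multiple of
    W^2 / S, the bilinear identity
      sum_(s,t) T_s T_t (B_s + B_t - 2 (A_s + A_t)^2) = 0.
    The bracket only involves the set D of indices l with s_i s_l = t_i t_l. For
    l in D let c_l be whichever of a_l, conj(a_l) has the charge of z, let d_l be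
    the other one, and put X_l = 1/(z - c_l), Y_l = 1/(z - d_l). The bracket is
    then a multiple of the leading coefficient of the remainder of
    prod_D (u + Y_l) modulo prod_(D\i) (u + X_l), hence, by Lagrange interpolation,
    a sum over k in D\i. The k-th summand times T_s T_t changes sign when s_k and
    t_k are both flipped, so the double sum vanishes term by term. *)

Set Implicit Arguments.
Unset Strict Implicit.
Unset Printing Implicit Defensive.

Import Order.TTheory GRing.Theory Num.Theory.
Import numFieldNormedType.Exports.

Local Open Scope ring_scope.
Local Open Scope complex_scope.

(** * Interpolation and the Ward identity *)

Section Interpolation.
Variables (K : fieldType) (I : finType) (X Y : I -> K).
Implicit Types A B : {set I}.

(** The divided difference of [u |-> \prod_(m in B) (u + Y m)] at the nodes [u = - X k] for [k] in
    [A]. *)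
Definition interp A B : K :=
  \sum_(k in A) \prod_(m in B) (Y m - X k) / \prod_(l in A :\ k) (X l - X k).

(** Split the factor of [m] as [Y m - X k = (Y m - X j) + (X j - X k)]; the second part cancels the
    node of [j]. *)
Lemma interp_expand A B j m : {in A &, injective X} -> j \in A -> m \in B ->
  interp A B = (Y m - X j) * interp A (B :\ m) + interp (A :\ j) (B :\ m).
Proof.
move=> injX jA mB; rewrite /interp mulr_sumr !(big_setD1 j jA) /=.
rewrite [in LHS](big_setD1 m mB) /= -!addrA mulrA; congr (_ + _).
rewrite -big_split /=; apply: eq_bigr => k /setD1P[kj kA].
have Xjk : X j - X k != 0.
  by rewrite subr_eq0; apply: contraNneq kj => /injX ->.
have jAk : j \in A :\ k by rewrite !inE eq_sym kj.
rewrite (big_setD1 m mB) /= (big_setD1 j jAk) /= finset.setDDl finset.setUC -finset.setDDl.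
rewrite invfM.
suff P0 : \prod_(l in (A :\ j) :\ k) (X l - X k) != 0 by field; rewrite Xjk P0.
apply/prodf_neq0 => l /setD1P[lk /setD1P[_ lA]].
by rewrite subr_eq0; apply: contraNneq lk => /injX ->.
Qed.

(** The recursion of divided differences. Each term on the left extends to a sum over all of [A],
    the missing summand getting the weight [X j - X k = 0]. *)
Lemma interp_diff A B j1 j2 : {in A &, injective X} -> j1 \in A -> j2 \in A ->
  interp (A :\ j1) B - interp (A :\ j2) B = (X j1 - X j2) * interp A B.
Proof.
move=> injX.
have H j : j \in A -> interp (A :\ j) B =
    \sum_(k in A) (X j - X k) * (\prod_(m in B) (Y m - X k) / \prod_(l in A :\ k) (X l - X k)).
  move=> jA; rewrite [RHS](big_setD1 j jA) /= subrr mul0r add0r.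
  apply: eq_bigr => k /setD1P[kj kA].
  have Xjk : X j - X k != 0.
    by rewrite subr_eq0; apply: contraNneq kj => /injX ->.
  have jAk : j \in A :\ k by rewrite !inE eq_sym kj.
  rewrite (big_setD1 j jAk) /= finset.setDDl finset.setUC -finset.setDDl invfM.
  suff P0 : \prod_(l in (A :\ k) :\ j) (X l - X k) != 0 by field; rewrite Xjk P0.
  apply/prodf_neq0 => l /setD1P[_ /setD1P[lk lA]].
  by rewrite subr_eq0; apply: contraNneq lk => /injX ->.
move=> j1A j2A; rewrite !H // -sumrB mulr_sumr; apply: eq_bigr => k _; ring.
Qed.

Lemma injD1 A j : {in A &, injective X} -> {in A :\ j &, injective X}.
Proof. by move=> H x y /setD1P[_ xA] /setD1P[_ yA]; apply: H. Qed.

(** This is the leading coefficient of a monic polynomial of degree [#|A| - 1]. In [interp_expand]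
    the last term is 1 by induction, and the other one vanishes. *)
Lemma interp_deg0 A B : {in A &, injective X} -> #|A| = #|B|.+1 -> interp A B = 1.
Proof.
have [p] := ubnP #|A|; elim: p => // p IHp in A B *; rewrite ltnS => Ap injX AB.
have /card_gt0P[j jA] : (0 < #|A|)%N by rewrite AB.
have A'B : #|A :\ j| = #|B| by move: AB; rewrite (cardsD1 j) jA => -[].
have [B0|[m mB]] := set_0Vmem B.
  move: A'B; rewrite B0 cards0 => /cards0_eq A'0.
  by rewrite /interp (big_setD1 j jA) /= A'0 !big_set0 divr1 addr0.
have B'B : #|B| = #|B :\ m|.+1 by rewrite (cardsD1 m B) mB.
have A'p k : k \in A -> (#|A :\ k| < p)%N.
  by move=> kA; move: Ap; rewrite (cardsD1 k A) kA.
have A'B' k : k \in A -> #|A :\ k| = #|B :\ m|.+1.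
  by move=> kA; move: AB; rewrite (cardsD1 k A) kA B'B => -[].
have IH k : k \in A -> interp (A :\ k) (B :\ m) = 1.
  by move=> kA; apply: IHp; [exact: A'p|exact: injD1|exact: A'B'].
rewrite (interp_expand injX jA mB) IH //.
have /card_gt0P[j2 /setD1P[j2j j2A]] : (0 < #|A :\ j|)%N by rewrite A'B B'B.
(* Removing [j] or [j2] gives 1 in both cases, so [interp A (B :\ m)] is 0. *)
have /eqP := interp_diff (B :\ m) injX jA j2A.
rewrite !IH // subrr eq_sym mulf_eq0 subr_eq0 => /orP[/eqP/injX e|/eqP->].
  by rewrite e ?eqxx // in j2j.
by rewrite mulr0 add0r.
Qed.

(** By [interp_expand] and [interp_deg0], each removed pair contributes [Y m - X j]. *)
Lemma interp_deg1 A B : {in A &, injective X} -> #|A| = #|B| ->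
  interp A B = \sum_(m in B) Y m - \sum_(k in A) X k.
Proof.
have [p] := ubnP #|A|; elim: p => // p IHp in A B *; rewrite ltnS => Ap injX AB.
have [A0|[j jA]] := set_0Vmem A.
  move: AB; rewrite A0 cards0 => /esym/cards0_eq->.
  by rewrite /interp !big_set0 subrr.
have /card_gt0P[m mB] : (0 < #|B|)%N by rewrite -AB (cardsD1 j) jA.
have A'B' : #|A :\ j| = #|B :\ m| by move: AB; rewrite (cardsD1 j) jA (cardsD1 m B) mB => -[].
rewrite (interp_expand injX jA mB) interp_deg0 //; last by rewrite AB (cardsD1 m) mB.
rewrite IHp //; first by rewrite (big_setD1 m mB) /= (big_setD1 j jA) /=; ring.
- by move: Ap; rewrite (cardsD1 j A) jA.
- exact: injD1.
Qed.

(* The complete homogeneous polynomial of degree 2 in the difference of the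
   alphabets Y and X. *)
Lemma interp_deg2 A B : {in A &, injective X} -> #|B| = #|A|.+1 ->
  2 * interp A B = \sum_(k in A) X k ^+ 2 - \sum_(m in B) Y m ^+ 2
    + (\sum_(k in A) X k - \sum_(m in B) Y m) ^+ 2.
Proof.
have [p] := ubnP #|A|; elim: p => // p IHp in A B *; rewrite ltnS => Ap injX BA.
have /card_gt0P[m mB] : (0 < #|B|)%N by rewrite BA.
have B'A : #|B :\ m| = #|A| by move: BA; rewrite (cardsD1 m) mB => -[].
have [A0|[j jA]] := set_0Vmem A.
  move: B'A; rewrite A0 cards0 => /cards0_eq B'0.
  by rewrite /interp !(big_setD1 m mB) /= B'0 !big_set0; ring.
rewrite (interp_expand injX jA mB) interp_deg1 //.
rewrite mulrDr IHp //; first last.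
- by rewrite B'A (cardsD1 j) jA.
- exact: injD1.
- by move: Ap; rewrite (cardsD1 j A) jA.
rewrite !(big_setD1 m mB) /= !(big_setD1 j jA) /=; ring.
Qed.

End Interpolation.

(* The [l = k] terms are [_ / 0 = 0]. *)
Lemma ward (K : numFieldType) (J : finType) (Z q : J -> K) (i : J) :
  injective Z -> (forall k, q k ^+ 2 = 1) ->
  \sum_(k | k != i) (Z k - Z i)^-1 * \sum_l q k * q l / (Z k - Z l) =
  \sum_l q i * q l / (Z i - Z l) ^+ 2
  - 2^-1 * (\sum_l q i * q l / (Z i - Z l)) ^+ 2
  + 2^-1 * \sum_(k | k != i) (Z k - Z i) ^- 2.
Proof.
move=> Zinj q2.
have Zn k l : k != l -> Z k - Z l != 0.
  by move=> kl; rewrite subr_eq0 (inj_eq Zinj).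
pose x k := (Z i - Z k)^-1.
have xi : x i = 0 by rewrite /x subrr invr0.
pose w k l := (Z k - Z i)^-1 * (q k * q l / (Z k - Z l)).
have E1 : \sum_(k | k != i) (Z k - Z i)^-1 * \sum_l q k * q l / (Z k - Z l) =
    \sum_(k | k != i) q i * q k * x k ^+ 2 + \sum_(k | k != i) \sum_(l | l != i) w k l.
  rewrite -big_split /=; apply: eq_bigr => k ki.
  rewrite (bigD1 i) //= mulrDr mulr_sumr; congr (_ + _).
  by rewrite /x; field; rewrite !Zn // eq_sym.
have E2 : (\sum_l q i * q l / (Z i - Z l)) ^+ 2 =
    \sum_(k | k != i) \sum_(l | l != i) q k * q l * x k * x l.
  rewrite -[LHS]mul1r -(q2 i) -exprMn mulr_sumr (bigD1 i) //= subrr invr0 !mulr0 add0r.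
  rewrite expr2 mulr_suml; apply: eq_bigr => k ki.
  rewrite mulr_sumr; apply: eq_bigr => l li.
  rewrite -[RHS]mul1r -[X in X * _ = _]mulr1.
  transitivity ((q i ^+ 2) ^+ 2 * (q k * q l * x k * x l)); first by rewrite /x; ring.
  by rewrite q2 expr1n.
(* Symmetrize in [k] and [l]: for [k != l] partial fractions give
   [w k l + w l k = - q k * q l * x k * x l]. The first sum on the right compensates the diagonal,
   where [q k ^+ 2 = 1]. *)
have E3 : 2 * \sum_(k | k != i) \sum_(l | l != i) w k l =
    \sum_(k | k != i) x k ^+ 2 - \sum_(k | k != i) \sum_(l | l != i) q k * q l * x k * x l.
  rewrite mulr_natl mulr2n {2}exchange_big /= -big_split -sumrB /=.
  apply: eq_bigr => k ki; rewrite -big_split /= [in LHS](bigD1 k ki) [in RHS](bigD1 k ki) /=.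
  rewrite /w subrr invr0 !mulr0 addr0 add0r.
  have -> : x k ^+ 2 = q k * q k * x k * x k.
    by rewrite -[LHS]mul1r -(q2 k); ring.
  rewrite opprD addrA subrr add0r -sumrN; apply: eq_bigr => l /andP[li lk].
  by rewrite /x; field; rewrite !Zn // eq_sym.
rewrite E1.
have -> : \sum_l q i * q l / (Z i - Z l) ^+ 2 = \sum_(k | k != i) q i * q k * x k ^+ 2.
  rewrite (bigD1 i) //= subrr expr0n invr0 mulr0 add0r; apply: eq_bigr => k ki.
  by rewrite /x exprVn.
rewrite E2 -[X in _ + X](mulKf (x := 2)) ?pnatr_eq0 // E3 mulrBr.
have -> : \sum_(k | k != i) (Z k - Z i) ^- 2 = \sum_(k | k != i) x k ^+ 2.
  by apply: eq_bigr => k ki; rewrite /x -sqrrN opprB exprVn.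
ring.
Qed.

(** * The bilinear identity *)

Definition flip (I : finType) (k : I) (s : {ffun I -> bool}) : {ffun I -> bool} :=
  [ffun l => s l (+) (l == k)].

Lemma flipK (I : finType) (k : I) : involutive (@flip I k).
Proof. by move=> s; apply/ffunP => l; rewrite !ffunE -addbA addbb addbF. Qed.

(** The cross-ratio of the pairs at [k] and [l]. For mirror pairs it is the inverse square of the
    modulus of [(z_k - z_l) / (z_k - conj z_l)]. *)
Definition cross (K : fieldType) (I : Type) (Z : I -> bool -> K) (k l : I) : K :=
  (Z k false - Z l true) * (Z k true - Z l false)
  / ((Z k false - Z l false) * (Z k true - Z l true)).

Definition charge (K : pzRingType) (I : Type) (s : I -> bool) (p : I * bool) : K :=
  (-1) ^+ (s p.1 (+) p.2).

(* The self-interaction term [r = p] is [_ / 0 = 0] for [0 < n]. *)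
Definition coulomb (K : fieldType) (I : finType) (Z : I -> bool -> K) (n : nat)
    (s : I -> bool) (p : I * bool) : K :=
  \sum_r charge K s p * charge K s r / (Z p.1 p.2 - Z r.1 r.2) ^+ n.

(** * Vanishing of the double sum over spin configurations *)

Section Core.
Variables (K : fieldType) (I : finType) (Z : I -> bool -> K) (i : I).
Variable T : {ffun I -> bool} -> K.
Hypothesis two_neq0 : 2 != 0 :> K.
Hypothesis Zinj : forall k l c d, Z k c = Z l d -> k = l /\ c = d.
(** Flipping [k] inverts the interaction of [k] with every [l]. In a product of two weights the
    exponents cancel where the relative spins of [k] and [l] differ, and add up elsewhere, which
    turns fractional powers into cross-ratios. *)
Hypothesis T_flip : forall s t k, T (flip k s) * T (flip k t) = T s * T t *
  \prod_(l | (l != k) && (s k (+) s l == t k (+) t l))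
    (if s k == s l then cross Z k l else (cross Z k l)^-1).

Implicit Types s t : {ffun I -> bool}.

(** Since [0^-1 = 0], [v i false] is 0 rather than infinity. Hence [X s i = 0] and
    [Y s i = v i true], and [v] is still injective. *)
Let v k c := (Z i false - Z k c)^-1.
Let X s k := v k (s i (+) s k).
Let Y s k := v k (~~ (s i (+) s k)).
Let D s t := [set l | s i (+) s l == t i (+) t l].

Let vinj k l c d : v k c = v l d -> k = l /\ c = d.
Proof. by move/invr_inj/addrI/oppr_inj/Zinj. Qed.

Let vB0 k l c d : (k, c) != (l, d) -> v k c - v l d != 0.
Proof. by apply: contraNneq => /eqP; rewrite subr_eq0 => /eqP/vinj[-> ->]. Qed.

Let ZB0 k l c d : (k, c) != (l, d) -> Z k c - Z l d != 0.
Proof. by apply: contraNneq => /eqP; rewrite subr_eq0 => /eqP/Zinj[-> ->]. Qed.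

(** The cross-ratio is invariant under the Moebius map [w |-> 1 / (z - w)]; unequal spins swap the
    two points of one pair, which inverts it. *)
Let cross_v s k l : k != i -> l != i -> l != k ->
  (if s k == s l then cross Z k l else (cross Z k l)^-1) =
  (X s k - Y s l) * (Y s k - X s l) / ((X s k - X s l) * (Y s k - Y s l)).
Proof.
move=> ki li lk.
have N m c : m != i -> Z i false - Z m c != 0 by move=> mi; rewrite ZB0 // xpair_eqE eq_sym (negbTE mi).
have M c d : Z k c - Z l d != 0 by rewrite ZB0 // xpair_eqE eq_sym (negbTE lk).
have M' c d : Z l d - Z k c != 0 by rewrite -opprB oppr_eq0.
have E c d : v k c - v l d = (Z k c - Z l d) / ((Z i false - Z k c) * (Z i false - Z l d)).
  by rewrite /v; field; rewrite !N.
rewrite /X /Y !E /cross.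
by case: (s i) (s k) (s l) => [] [] [] /=; field; rewrite ?N ?M ?M'.
Qed.

(** The Moebius map sends [Z i false] to infinity, so the two factors containing it drop out. *)
Let cross_vi s k : k != i ->
  (if s k == s i then cross Z k i else (cross Z k i)^-1) = (Y s i - X s k) / (Y s i - Y s k).
Proof.
move=> ki.
have N c : Z i false - Z k c != 0 by rewrite ZB0 // xpair_eqE eq_sym (negbTE ki).
have M c d : Z k c - Z i d != 0 by rewrite ZB0 // xpair_eqE (negbTE ki).
have M' c d : Z i d - Z k c != 0 by rewrite -opprB oppr_eq0.
have L : Z i false - Z i true != 0 by rewrite ZB0 // xpair_eqE andbF.
have E c : v i true - v k c = (Z i true - Z k c) / ((Z i false - Z k c) * (Z i false - Z i true)).
  by rewrite /v; field; rewrite !N L.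
rewrite /X /Y addbb /= !E /cross.
by case: (s i) (s k) => [] [] /=; field; rewrite ?N ?M ?M' ?L.
Qed.

Let term s t k := T s * T t *
  (\prod_(m in D s t) (Y s m - X s k) / \prod_(l in D s t :\ i :\ k) (X s l - X s k)).

Let D_flip s t k : k != i -> D (flip k s) (flip k t) = D s t.
Proof.
move=> ki; apply/setP => l; rewrite !inE !ffunE eq_sym [i == k]eq_sym (negbTE ki) !addbF.
by case: (l == k) (s i) (s l) (t i) (t l) => [] [] [] [] [].
Qed.

(* By [T_flip] the weights contribute exactly the quotient of the interpolation
   products, up to the sign of [X s k - Y s k]. *)
Let term_flip s t k : k \in D s t :\ i ->
  term (flip k s) (flip k t) k = - term s t k.
Proof.
move=> /setD1P[ki kD].
have iD : i \in D s t by rewrite inE !addbb.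
have kDi : k \in D s t :\ i by rewrite in_setD1 ki.
have X'k : X (flip k s) k = Y s k.
  by rewrite /X /Y !ffunE eqxx eq_sym (negbTE ki) addbF addbT addbN.
have Y'k : Y (flip k s) k = X s k.
  by rewrite /X /Y !ffunE eqxx eq_sym (negbTE ki) addbF addbT addbN negbK.
have X'l l : l != k -> X (flip k s) l = X s l.
  by move=> lk; rewrite /X !ffunE (negbTE lk) eq_sym (negbTE ki) !addbF.
have Y'l l : l != k -> Y (flip k s) l = Y s l.
  by move=> lk; rewrite /Y !ffunE (negbTE lk) eq_sym (negbTE ki) !addbF.
rewrite /term D_flip // X'k T_flip.
rewrite !(big_setD1 i iD) /= !(big_setD1 k kDi) /=.
set E := D s t :\ i :\ k.
have EP l : l \in E -> [/\ l != k, l != i & l \in D s t].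
  by move=> /setD1P[? /setD1P[]].
have -> : \prod_(l | (l != k) && (s k (+) s l == t k (+) t l))
    (if s k == s l then cross Z k l else (cross Z k l)^-1) =
    (Y s i - X s k) / (Y s i - Y s k) * \prod_(l in E)
    ((X s k - Y s l) * (Y s k - X s l) / ((X s k - X s l) * (Y s k - Y s l))).
  (* As [k] is in [D s t], comparing spins with [k] or with [i] selects the same indices. *)
  have kDE l : (l \in D s t) = (s k (+) s l == t k (+) t l).
    move: kD; rewrite !inE.
    by case: (s i) (s l) (t i) (t l) (s k) (t k) => [] [] [] [] [] [].
  rewrite (bigD1 i) /=; last by rewrite eq_sym ki -kDE.
  rewrite cross_vi //; congr (_ * _); apply: eq_big => [l|l /andP[/andP[lk _] li]].
    by rewrite !inE -kDE inE; case: (l == i) (l == k) => [] [] /=; rewrite ?andbF ?andbT.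
  by rewrite cross_v.
rewrite Y'k Y'l 1?eq_sym // [\prod_(l in E) (Y (flip k s) l - _)](eq_bigr (fun m => Y s m - Y s k)); last first.
  by move=> l /EP[lk _ _]; rewrite Y'l.
rewrite [\prod_(l in E) (X (flip k s) l - _)](eq_bigr (fun m => X s m - Y s k)); last first.
  by move=> l /EP[lk _ _]; rewrite X'l.
have XYk : X s k - Y s k != 0 by apply: vB0; rewrite xpair_eqE eqxx; case: (_ (+) _).
have YiYk : Y s i - Y s k != 0 by apply: vB0; rewrite xpair_eqE eq_sym (negbTE ki).
(* The flip factors of [E] restore the original quotient. The factor of [i] restores the numerator
   at [m = i], and the numerator at [m = k] changes sign. *)
have P : \prod_(l in E) ((X s k - Y s l) * (Y s k - X s l) / ((X s k - X s l) * (Y s k - Y s l)))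
    * (\prod_(l in E) (Y s l - Y s k) / \prod_(l in E) (X s l - Y s k)) =
    \prod_(l in E) (Y s l - X s k) / \prod_(l in E) (X s l - X s k).
  rewrite -!prodf_div -big_split /=; apply: eq_bigr => l /EP[lk _ _].
  have N c d : v l c - v k d != 0 by rewrite vB0 // xpair_eqE (negbTE lk).
  have N' c d : v k d - v l c != 0 by rewrite -opprB oppr_eq0.
  by rewrite /X /Y; field; rewrite ?N ?N'.
have Q : \prod_(l in E) (X s l - Y s k) != 0.
  by apply/prodf_neq0 => l /EP[lk _ _]; rewrite vB0 // xpair_eqE (negbTE lk).
rewrite -![_ * _ / _]mulrA -P; field.
by rewrite YiYk Q.
Qed.

Let spin_sum_eq0 :
  \sum_s \sum_t T s * T t * (\sum_(k in D s t) (X s k ^+ 2 - Y s k ^+ 2)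
    + (\sum_(k in D s t) (X s k - Y s k)) ^+ 2) = 0.
Proof.
(* As [X s i = 0], the sums of [X] over [D s t] and over [D s t :\ i] agree, and [interp_deg2]
   applies. *)
have Br s t : \sum_(k in D s t) (X s k ^+ 2 - Y s k ^+ 2)
    + (\sum_(k in D s t) (X s k - Y s k)) ^+ 2 = 2 * interp (X s) (Y s) (D s t :\ i) (D s t).
  have iD : i \in D s t by rewrite inE !addbb.
  rewrite interp_deg2; last by rewrite (cardsD1 i) iD.
    have Xi : X s i = 0 by rewrite /X /v addbb subrr invr0.
    rewrite !sumrB !(big_setD1 i iD) /= !Xi; ring.
  by move=> k l _ _ /vinj[].
under eq_bigr do under eq_bigr do rewrite Br mulrCA mulr_sumr.
rewrite pair_big /= -mulr_sumr; apply/eqP; rewrite mulf_eq0 (negbTE two_neq0) /=; apply/eqP.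
(* With [k] fixed, flipping [k] in both configurations is an involution of the pairs summed over,
   and it negates each summand by [term_flip]. *)
rewrite (exchange_big_dep predT) //= big1 // => k _.
set S := \sum_(p | _) _.
suff : S = - S by move/eqP; rewrite -addr_eq0 -mulr2n -mulr_natl mulf_eq0 (negbTE two_neq0) => /eqP.
pose f (p : {ffun I -> bool} * {ffun I -> bool}) := (flip k p.1, flip k p.2).
have fK : involutive f by case=> s t; rewrite /f /= !flipK.
rewrite {1}/S (reindex_inj (inv_inj fK)) -sumrN /=.
apply: eq_big => [[s t]|[s t]] /=.
  have [->|ki] := eqVneq k i; first by rewrite !inE eqxx.
  by rewrite D_flip.
rewrite in_setD1 => /andP[ki]; rewrite D_flip // => kD.
by have := @term_flip s t k; rewrite /term D_flip // in_setD1 ki; apply.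
Qed.

(** Expanding the bracket of [spin_sum_eq0] in Coulomb sums separates the double sum into products
    of single sums. *)
Lemma spin_sum_coulomb :
  (\sum_s T s) * (\sum_s T s * coulomb Z 2 s (i, false)) +
  2^-1 * ((\sum_s T s) * (\sum_s T s * coulomb Z 1 s (i, false) ^+ 2)
          + (\sum_s T s * coulomb Z 1 s (i, false)) ^+ 2) = 0.
Proof.
pose a n s := coulomb Z n s (i, false).
have aE n s : (0 < n)%N -> a n s = \sum_k (X s k ^+ n - Y s k ^+ n).
  move=> n0; rewrite /a /coulomb -(pair_bigA _ (fun k c => _ * charge K s (k, c) / (_ - Z k c) ^+ n)) /=.
  apply: eq_bigr => k _; rewrite big_bool /X /Y /v /charge /= addbF.
  by case: (s i) (s k) => [] [] /=; rewrite -?exprVn; ring.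
(* Outside [D s t] the configuration [t] exchanges the [X] and [Y] of [s], so the contributions
   cancel; inside they coincide. *)
have aD n s t : (0 < n)%N -> a n s + a n t = 2 * \sum_(k in D s t) (X s k ^+ n - Y s k ^+ n).
  move=> n0; rewrite !aE // -big_split /= mulr_sumr [RHS]big_mkcond; apply: eq_bigr => k _.
  by rewrite inE /X /Y; case: (s i) (s k) (t i) (t k) => [] [] [] [] /=; ring.
have four_neq0 : 4 != 0 :> K.
  by rewrite (_ : 4 = 2 * 2) ?mulf_neq0 //; ring.
have := spin_sum_eq0.
have -> : \sum_s \sum_t T s * T t * (\sum_(k in D s t) (X s k ^+ 2 - Y s k ^+ 2)
    + (\sum_(k in D s t) (X s k - Y s k)) ^+ 2) =
  \sum_s \sum_t (2^-1 * (T t * (T s * a 2%N s)) + 2^-1 * (T s * (T t * a 2%N t))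
    + (4^-1 * (T t * (T s * a 1%N s ^+ 2)) + 4^-1 * (T s * (T t * a 1%N t ^+ 2)))
    + 2^-1 * ((T s * a 1%N s) * (T t * a 1%N t))).
  apply: eq_bigr => s _; apply: eq_bigr => t _.
  have -> := canRL (mulKf two_neq0) (esym (aD 2%N s t isT)).
  have -> : \sum_(k in D s t) (X s k - Y s k) = 2^-1 * (a 1%N s + a 1%N t).
    exact: (canRL (mulKf two_neq0) (esym (aD 1%N s t isT))).
  by field; rewrite two_neq0 four_neq0.
set W := \sum_s T s.
under eq_bigr do rewrite !big_split /= -!mulr_sumr -!mulr_suml -/W.
rewrite !big_split /= -!mulr_sumr -!mulr_suml.
move=> E; rewrite -[RHS]E -/W /a; field.
by rewrite two_neq0 four_neq0.
Qed.

End Core.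

(** * Reduction of the BPZ equation to the bilinear identity *)

Lemma sum_pair_neq (V : nmodType) (I : finType) (i : I) (F : I * bool -> V) :
  \sum_(p | p != (i, false)) F p = \sum_(k | k != i) F (k, false) + \sum_k F (k, true).
Proof.
rewrite big_mkcond /= (eq_bigr (fun p => (fun k c => if (k, c) != (i, false) then F (k, c) else 0) p.1 p.2)); last by case.
rewrite -(pair_bigA _ (fun k c => if (k, c) != (i, false) then F (k, c) else 0)) /=.
rewrite [X in _ = X + _]big_mkcond -big_split /=; apply: eq_bigr => k _.
by rewrite big_bool /= !xpair_eqE andbF andbT addrC.
Qed.

(** This is the equation divided by [S = W^(1/2)]: [A s] is the logarithmic derivative of [T s], [L]
    that of [S], and [L'] the derivative of [L i0] in [z], so that [L i0 ^+ 2 + L'] is [S'' / S].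
    The sums over [p] treat points and mirror images alike. *)
Lemma bpz_algebra (K : numFieldType) (I : finType) (Z : I -> bool -> K) (i : I)
    (T : {ffun I -> bool} -> K) :
  (forall k l c d, Z k c = Z l d -> k = l /\ c = d) ->
  (forall s t k, T (flip k s) * T (flip k t) = T s * T t *
    \prod_(l | (l != k) && (s k (+) s l == t k (+) t l))
      (if s k == s l then cross Z k l else (cross Z k l)^-1)) ->
  let W := \sum_s T s in
  let A s p := 4^-1 * coulomb Z 1 s p in
  let L p := (\sum_s T s * A s p) / (2 * W) in
  let i0 := (i, false) in
  let L' := (\sum_s T s * (A s i0 ^+ 2 - 4^-1 * coulomb Z 2 s i0)) / (2 * W)
            - (\sum_s T s * A s i0) ^+ 2 / (2 * W ^+ 2) in
  W != 0 ->
  8 / 3 * (L i0 ^+ 2 + L')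
  + \sum_(p | p != i0) 2 / (Z p.1 p.2 - Z i false) * L p
  - \sum_(p | p != i0) 8^-1 / (Z p.1 p.2 - Z i false) ^+ 2 = 0.
Proof.
move=> Zinj T_flip W A L i0 L' W0.
have two_neq0 : 2 != 0 :> K by rewrite pnatr_eq0.
have core := spin_sum_coulomb i two_neq0 Zinj T_flip.
pose N := \sum_s T s * coulomb Z 1 s i0.
pose M := \sum_s T s * coulomb Z 1 s i0 ^+ 2.
pose B := \sum_s T s * coulomb Z 2 s i0.
pose Q := \sum_(p | p != i0) (Z p.1 p.2 - Z i false) ^- 2.
have {core} core : W * B + 2^-1 * (W * M + N ^+ 2) = 0 := core.
have -> : \sum_(p | p != i0) 8^-1 / (Z p.1 p.2 - Z i false) ^+ 2 = 8^-1 * Q.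
  by rewrite mulr_sumr.
have -> : \sum_(p | p != i0) 2 / (Z p.1 p.2 - Z i false) * L p =
    (4 * W)^-1 * (B - 2^-1 * M + 2^-1 * Q * W).
  (* After exchanging the sums, [ward] applies for each fixed [s] to all the doubled points. *)
  transitivity ((4 * W)^-1 * \sum_s T s * \sum_(p | p != i0)
      (Z p.1 p.2 - Z i0.1 i0.2)^-1 * coulomb Z 1 s p).
    under [in RHS]eq_bigr do rewrite mulr_sumr.
    rewrite exchange_big /= mulr_sumr; apply: eq_bigr => p _.
    rewrite /L /A mulrCA mulr_suml [RHS]mulr_sumr; apply: eq_bigr => s _.
    set z := (_ - _)^-1; field; exact: W0.
  congr (_ * _).
  rewrite (_ : B - _ + _ = \sum_s T s * (coulomb Z 2 s i0 - 2^-1 * coulomb Z 1 s i0 ^+ 2 + 2^-1 * Q)).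
    apply: eq_bigr => s _; congr (_ * _).
    rewrite /Q; apply: (@ward K _ (fun p => Z p.1 p.2) (charge K s) i0).
      by move=> [k c] [l d] /= /Zinj[-> ->].
    by move=> p; rewrite /charge sqrr_sign.
  rewrite /B /M /W !mulr_sumr -sumrN -!big_split /=; apply: eq_bigr => s _; ring.
have -> : L i0 = N / (8 * W).
  rewrite /L /A /N.
  have -> : \sum_s T s * (4^-1 * coulomb Z 1 s i0) = 4^-1 * \sum_s T s * coulomb Z 1 s i0.
    by rewrite mulr_sumr; apply: eq_bigr => s _; ring.
  by field; exact: W0.
have -> : L' = (16^-1 * M - 4^-1 * B) / (2 * W) - N ^+ 2 / (32 * W ^+ 2).
  rewrite /L' /A /N /M /B; congr (_ / _ - _).
    by rewrite !mulr_sumr -sumrB; apply: eq_bigr => s _; field.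
  have -> : \sum_s T s * (4^-1 * coulomb Z 1 s i0) = 4^-1 * \sum_s T s * coulomb Z 1 s i0.
    by rewrite mulr_sumr; apply: eq_bigr => s _; ring.
  by field; exact: W0.
(* The terms in [Q] cancel, and the left side is [- 1 / (12 * W ^+ 2)] times that of [core]; it
   remains to eliminate [B]. *)
have -> : B = - 2^-1 * (M + N ^+ 2 / W).
  apply: (mulfI W0); move/eqP: core; rewrite addr_eq0 => /eqP ->; field; exact: W0.
field; exact: W0.
Qed.

(** * Wirtinger calculus *)

Local Open Scope classical_set_scope.

(** * Complex-valued functions of a real variable *)

Section ComplexDerivative.
Variable R : realType.
Implicit Types (g h : R -> R[i]) (f : R -> R) (t : R) (d : R[i]).

Lemma ReD (x y : R[i]) : complex.Re (x + y) = complex.Re x + complex.Re y.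
Proof. by case: x y => ? ? []. Qed.
Lemma ImD (x y : R[i]) : complex.Im (x + y) = complex.Im x + complex.Im y.
Proof. by case: x y => ? ? []. Qed.
Lemma ReM (x y : R[i]) :
  complex.Re (x * y) = complex.Re x * complex.Re y - complex.Im x * complex.Im y.
Proof. by case: x y => ? ? []. Qed.
Lemma ImM (x y : R[i]) :
  complex.Im (x * y) = complex.Re x * complex.Im y + complex.Im x * complex.Re y.
Proof. by case: x y => ? ? []. Qed.

Lemma conjcD (x y : R[i]) : (x + y)^*%C = x^*%C + y^*%C.
Proof. exact: rmorphD. Qed.
Lemma conjcB (x y : R[i]) : (x - y)^*%C = x^*%C - y^*%C.
Proof. exact: rmorphB. Qed.
Lemma conjc_sum (I : finType) (F : I -> R[i]) : (\sum_r F r)^*%C = \sum_r (F r)^*%C.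
Proof. exact: rmorph_sum. Qed.
Lemma conjcM (x y : R[i]) : (x * y)^*%C = x^*%C * y^*%C.
Proof. exact: rmorphM. Qed.
Lemma realcV (x : R) : (x^-1)%:C = (x%:C)^-1.
Proof. exact: fmorphV. Qed.
Lemma realcM (x y : R) : (x * y)%:C = x%:C * y%:C.
Proof. exact: rmorphM. Qed.

Lemma is_derive_ext (f1 f2 : R -> R) (t d1 d2 : R) :
  is_derive t 1 f1 d1 -> f1 =1 f2 -> d1 = d2 -> is_derive t 1 f2 d2.
Proof. by move=> + /funext <- <-. Qed.

Definition is_cderive g t d : Prop :=
  is_derive t 1 (fun s => complex.Re (g s)) (complex.Re d) /\
  is_derive t 1 (fun s => complex.Im (g s)) (complex.Im d).

Lemma is_cderiveE g t d : is_cderive g t d -> cderivable g t /\ cderive g t = d.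
Proof.
move=> [gr gi]; split; first by split; exact: ex_derive.
by rewrite /cderive !derive1E !derive_val; case: d {gr gi}.
Qed.

Lemma is_cderive_eq g t d d' : is_cderive g t d -> d = d' -> is_cderive g t d'.
Proof. by move=> + <-. Qed.

Lemma near_eq_is_cderive g h t d : (\near t, g t = h t) ->
  is_cderive g t d -> is_cderive h t d.
Proof.
move=> gh [gr gi]; split.
- apply: near_eq_is_derive gr; near=> s; congr complex.Re; near: s; exact: gh.
- apply: near_eq_is_derive gi; near=> s; congr complex.Im; near: s; exact: gh.
Unshelve. all: by end_near. Qed.

Lemma is_cderive_cst (c : R[i]) t : is_cderive (fun=> c) t 0.
Proof. by split; exact: is_derive_cst. Qed.

Lemma is_cderive_real f t (d : R) :
  is_derive t 1 f d -> is_cderive (fun s => (f s)%:C) t d%:C.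
Proof. by move=> fd; split => //=; exact: is_derive_cst. Qed.

Lemma is_cderive_realP f t d : is_cderive (fun s => (f s)%:C) t d ->
  d = (complex.Re d)%:C /\ is_derive t 1 f (complex.Re d).
Proof.
move=> [/= fr fi]; split=> //.
have := @derive_val _ _ _ _ _ _ _ fi; rewrite derive_cst.
by case: d {fr fi} => x y /= <-.
Qed.

Lemma is_cderiveD g h t c d : is_cderive g t c -> is_cderive h t d ->
  is_cderive (fun s => g s + h s) t (c + d).
Proof.
move=> [gr gi] [hr hi]; split.
- apply: (is_derive_ext (is_deriveD gr hr)); last by rewrite ReD.
  by move=> s; rewrite ReD.
- apply: (is_derive_ext (is_deriveD gi hi)); last by rewrite ImD.
  by move=> s; rewrite ImD.
Qed.

Lemma is_cderiveM g h t c d : is_cderive g t c -> is_cderive h t d ->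
  is_cderive (fun s => g s * h s) t (c * h t + g t * d).
Proof.
move=> [gr gi] [hr hi]; split.
- apply: (is_derive_ext (is_deriveB (is_deriveM gr hr) (is_deriveM gi hi))).
    by move=> s; rewrite ReM.
  by rewrite ReD !ReM /GRing.scale /=; ring.
- apply: (is_derive_ext (is_deriveD (is_deriveM gr hi) (is_deriveM gi hr))).
    by move=> s; rewrite ImM.
  by rewrite ImD !ImM /GRing.scale /=; ring.
Qed.

Lemma is_cderive_conj g t d : is_cderive g t d -> is_cderive (fun s => (g s)^*%C) t d^*%C.
Proof.
move=> [gr gi]; split.
- by apply: (is_derive_ext gr) => [s|]; [case: (g s)|case: d {gr gi}].
- by apply: (is_derive_ext (is_deriveN gi)) => [s|]; [rewrite fctE; case: (g s)|case: d {gr gi}].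
Qed.

(** Writing [g^-1] as [conj g] times the inverse of the real function [|g|^2] reduces this to the
    real case. *)
Lemma is_cderiveV g t d : g t != 0 -> is_cderive g t d ->
  is_cderive (fun s => (g s)^-1) t (- d / g t ^+ 2).
Proof.
move=> g0 gd.
pose f s := complex.Re (g s) ^+ 2 + complex.Im (g s) ^+ 2.
have fE s : (f s)%:C = g s * (g s)^*%C.
  by rewrite -sqr_normc -add_Re2_Im2.
have f0 : f t != 0.
  apply: contraNneq g0 => ft0; move: (fE t); rewrite ft0 => /esym/eqP.
  by rewrite mulf_eq0 conjc_eq0 orbb.
have [df0 fd] : is_cderive (fun s => (f s)%:C) t (d * (g t)^*%C + g t * d^*%C).
  have -> : (fun s => (f s)%:C) = (fun s => g s * (g s)^*%C) by apply/funext.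
  exact/is_cderiveM/is_cderive_conj.
have [dE {}fd] := is_cderive_realP (conj df0 fd).
have fVE s : ((f s)^-1)%:C = (g s * (g s)^*%C)^-1 by rewrite -fE fmorphV.
have := is_cderiveM (is_cderive_conj gd) (is_cderive_real (is_deriveV f0 fd)).
have -> : (fun s => (g s)^*%C * ((f s)^-1)%:C) = (fun s => (g s)^-1).
  (* The equality holds at the zeros of [g] too, where both sides are 0. *)
  apply/funext => s; rewrite fVE; have [->|gs0] := eqVneq (g s) 0.
    by rewrite mul0r invr0 mulr0.
  by rewrite invfM mulrCA divff ?conjc_eq0 // mulr1.
rewrite fVE (_ : (- f t ^- 2 *: _)%:C = - (g t * (g t)^*%C) ^- 2 * (d * (g t)^*%C + g t * d^*%C)).
  congr is_cderive; field; by rewrite conjc_eq0 g0.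
by rewrite -[RHS]/(_ * _) dE -fE /GRing.scale /= rmorphM rmorphN fmorphV rmorphXn.
Qed.

Lemma is_cderive_powR f t d e : 0 < f t -> is_cderive (fun s => (f s)%:C) t d ->
  is_cderive (fun s => (f s `^ e)%:C) t ((e * f t `^ (e - 1))%:C * d).
Proof.
move=> f0 /is_cderive_realP[-> fd]; rewrite -rmorphM; apply: is_cderive_real.
exact: is_derive1_comp (is_derive1_powR e f0) fd.
Qed.

Lemma is_cderive_continuous g t d : is_cderive g t d ->
  {for t, continuous (fun s => complex.Re (g s))} /\
  {for t, continuous (fun s => complex.Im (g s))}.
Proof.
by move=> [[gr _] [gi _]]; split; apply/differentiable_continuous/derivable1_diffP.
Qed.

End ComplexDerivative.

(** * Calculus of pairs of Wirtinger derivatives *)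

Section HasWirtinger.
Variables (R : realType) (n : nat).
Implicit Types (F G : ('I_n -> R[i]) -> R[i]) (f : ('I_n -> R[i]) -> R).
Implicit Types (a b : 'I_n -> R[i]) (m k : 'I_n) (p q : R[i]).

(** Solving for [p] and [q] gives the holomorphic and antiholomorphic derivatives. Prescribing the
    partials in [x] and [y] makes the rules for [is_cderive] directly applicable. *)
Definition has_wirtinger m F a p q : Prop :=
  is_cderive (slice_x (in_var F a m) (a m)) (complex.Re (a m)) (p + q) /\
  is_cderive (slice_y (in_var F a m) (a m)) (complex.Im (a m)) ('i%C * (p - q)).

Lemma mulii : 'i%C * 'i%C = -1 :> R[i].
Proof. by rewrite -expr2 sqr_i. Qed.

Lemma has_wirtingerE m F a p q : has_wirtinger m F a p q ->
  [/\ partials_exist_at m F a, d_ m F a = p & dbar_ m F a = q].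
Proof.
move=> [/is_cderiveE[Fx Ex] /is_cderiveE[Fy Ey]]; split; first by split.
- by rewrite /d_ /wirtinger Ex Ey mulrA mulii; field.
- by rewrite /dbar_ /wirtinger_bar Ex Ey mulrA mulii; field.
Qed.

Lemma dfwith_eta a m : dfwith a m (complex.Re (a m) +i* complex.Im (a m)) = a.
Proof.
apply/funext => k; have [<-|mk] := eqVneq m k; last by rewrite dfwithout.
by rewrite dfwithin; case: (a m).
Qed.

Lemma has_wirtinger_eq m F a p q p' q' : has_wirtinger m F a p q ->
  p = p' -> q = q' -> has_wirtinger m F a p' q'.
Proof. by move=> + <- <-. Qed.

Lemma has_wirtinger_cst m (c : R[i]) a : has_wirtinger m (fun=> c) a 0 0.
Proof. by rewrite /has_wirtinger subrr mulr0 addr0; split; exact: is_cderive_cst. Qed.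

Lemma has_wirtinger_coord m k a : has_wirtinger m (fun b => b k) a (k == m)%:R 0.
Proof.
rewrite /has_wirtinger addr0 subr0.
have [->|km] := eqVneq k m; last first.
  have E g : (fun s : R => dfwith a m (g s) k) = fun=> a k.
    by apply/funext => s; rewrite dfwithout // eq_sym.
  by rewrite mulr0 /slice_x /slice_y /in_var !E; split; exact: is_cderive_cst.
have E g : (fun s : R => dfwith a m (g s) m) = g by apply/funext => s; rewrite dfwithin.
rewrite mulr1 /slice_x /slice_y /in_var !E.
by split; split => /=; [exact: is_derive_id|exact: is_derive_cst|exact: is_derive_cst|exact: is_derive_id].
Qed.

Lemma has_wirtinger_conj m F a p q : has_wirtinger m F a p q ->
  has_wirtinger m (fun b => (F b)^*%C) a q^*%C p^*%C.
Proof.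
move=> [Fx Fy]; split.
  by have := is_cderive_conj Fx; rewrite rmorphD addrC.
have := is_cderive_conj Fy; rewrite rmorphM rmorphB /= => H.
rewrite (_ : 'i%C * (q^*%C - p^*%C) = ('i%C)^*%C * (p^*%C - q^*%C)) //.
have -> : ('i%C)^*%C = - 'i%C :> R[i] by apply/eqP; rewrite eq_complex /= oppr0 !eqxx.
by ring.
Qed.

Lemma has_wirtingerD m F G a p q p' q' : has_wirtinger m F a p q ->
  has_wirtinger m G a p' q' -> has_wirtinger m (fun b => F b + G b) a (p + p') (q + q').
Proof.
move=> [Fx Fy] [Gx Gy]; split.
- by rewrite addrACA; exact: is_cderiveD.
- by rewrite opprD addrACA mulrDr; exact: is_cderiveD.
Qed.

Lemma has_wirtingerM m F G a p q p' q' : has_wirtinger m F a p q ->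
  has_wirtinger m G a p' q' ->
  has_wirtinger m (fun b => F b * G b) a (p * G a + F a * p') (q * G a + F a * q').
Proof.
move=> [Fx Fy] [Gx Gy]; split.
- by apply: is_cderive_eq (is_cderiveM Fx Gx) _; rewrite /slice_x /in_var !dfwith_eta; ring.
- by apply: is_cderive_eq (is_cderiveM Fy Gy) _; rewrite /slice_y /in_var !dfwith_eta; ring.
Qed.

Lemma has_wirtingerV m F a p q : F a != 0 -> has_wirtinger m F a p q ->
  has_wirtinger m (fun b => (F b)^-1) a (- p / F a ^+ 2) (- q / F a ^+ 2).
Proof.
move=> Fa0 [Fx Fy]; split.
- have := is_cderiveV _ Fx; rewrite /slice_x /in_var dfwith_eta => /(_ Fa0).
  by congr is_cderive; ring.
- have := is_cderiveV _ Fy; rewrite /slice_y /in_var dfwith_eta => /(_ Fa0).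
  by congr is_cderive; ring.
Qed.

Lemma has_wirtinger_sum m (I : Type) (r : seq I) (P : pred I) (F : I -> ('I_n -> R[i]) -> R[i])
    a (p q : I -> R[i]) :
  (forall j, P j -> has_wirtinger m (F j) a (p j) (q j)) ->
  has_wirtinger m (fun b => \sum_(j <- r | P j) F j b) a
    (\sum_(j <- r | P j) p j) (\sum_(j <- r | P j) q j).
Proof.
move=> FP; elim: r => [|j r IHr].
  by under eq_fun do rewrite big_nil; rewrite !big_nil; exact: has_wirtinger_cst.
under eq_fun do rewrite big_cons; rewrite !big_cons.
by case: ifPn => // /FP Fj; exact: has_wirtingerD.
Qed.

Lemma has_wirtinger_powR m f a p q e : 0 < f a ->
  has_wirtinger m (fun b => (f b)%:C) a p q ->
  has_wirtinger m (fun b => (f b `^ e)%:C) a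
    ((e * f a `^ (e - 1))%:C * p) ((e * f a `^ (e - 1))%:C * q).
Proof.
move=> fa0 [Fx Fy]; split.
- have := @is_cderive_powR _ _ _ _ e _ Fx; rewrite dfwith_eta => /(_ fa0).
  by rewrite mulrDr.
- have := @is_cderive_powR _ _ _ _ e _ Fy; rewrite dfwith_eta => /(_ fa0).
  by congr is_cderive; ring.
Qed.

(** Both partials are real, that is, [p + q] and ['i * (p - q)] are real. *)
Lemma has_wirtinger_real m f a p q :
  has_wirtinger m (fun b => (f b)%:C) a p q -> q = p^*%C.
Proof.
move=> [/is_cderive_realP[Ep _] /is_cderive_realP[Eq _]].
case: p q Ep Eq => x y [x' y'] /eqP + /eqP.
rewrite !eq_complex /= => /andP[_ /eqP E1] /andP[_ /eqP E2].
by apply/eqP; rewrite eq_complex /=; apply/andP; split; apply/eqP; lra.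
Qed.

(** * Openness of the configuration space, and logarithmic derivatives *)

Definition separated a : Prop := (forall k, 0 < complex.Im (a k)) /\ injective a.

(** Being separated amounts to finitely many open conditions, each preserved nearby by
    continuity. *)
Lemma near_separated (c : R -> 'I_n -> R[i]) (t : R) :
  (forall k, exists d, is_cderive (c ^~ k) t d) -> separated (c t) ->
  \forall s \near t, separated (c s).
Proof.
move=> dc [c0 cinj].
have [cr ci] : (forall k, {for t, continuous (fun s => complex.Re (c s k))}) /\
    (forall k, {for t, continuous (fun s => complex.Im (c s k))}).
  by split=> k; have [d /is_cderive_continuous[]] := dc k.
have H0 : \forall s \near t, forall k, 0 < complex.Im (c s k).
  apply: (@filter_forall _ _ (fun k s => 0 < complex.Im (c s k)) (nbhs t)) => k.
  exact: (cvgr_gt _ (ci k)).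
have H1 : \forall s \near t, forall kl : 'I_n * 'I_n, kl.1 != kl.2 -> c s kl.1 != c s kl.2.
  apply: (@filter_forall _ _ (fun kl s => kl.1 != kl.2 -> c s kl.1 != c s kl.2) (nbhs t)) => -[k l] /=.
  have [_|kl] := eqVneq k l; first by apply: filterE.
  have : c t k != c t l by rewrite (inj_eq cinj).
  (* Distinct points differ in real or in imaginary part, and that difference stays nonzero
     nearby. *)
  rewrite eq_complex negb_and -subr_eq0 -[complex.Im _ == _]subr_eq0 => /orP[] d0.
    apply: filterS (cvgr_neq0 _ (cvgB (cr k) (cr l)) d0) => s + _.
    by apply: contraNneq => E; rewrite !fctE /= E subrr.
  apply: filterS (cvgr_neq0 _ (cvgB (ci k) (ci l)) d0) => s + _.
  by apply: contraNneq => E; rewrite !fctE /= E subrr.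
near=> s; split; first by near: s.
move=> k l /eqP; apply: contraTeq => kl.
have H : forall kl : 'I_n * 'I_n, kl.1 != kl.2 -> c s kl.1 != c s kl.2 by near: s; exact: H1.
exact: (H (k, l) kl).
Unshelve. all: by end_near. Qed.

Lemma separated_slices m a : separated a ->
  (\forall x \near complex.Re (a m), separated (dfwith a m (x +i* complex.Im (a m)))) /\
  (\forall y \near complex.Im (a m), separated (dfwith a m (complex.Re (a m) +i* y))).
Proof.
move=> sa; split; apply: near_separated; rewrite ?dfwith_eta // => k;
  have [] := has_wirtinger_coord m k a; rewrite addr0 subr0 => dx dy.
- by exists (k == m)%:R.
- by exists ('i%C * (k == m)%:R).
Qed.

(** Needed for second derivatives: the formula for [d_ i F] is established on separated
    configurations only. *)
Lemma has_wirtinger_separated m F G a p q : (forall b, separated b -> F b = G b) ->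
  separated a -> has_wirtinger m F a p q -> has_wirtinger m G a p q.
Proof.
move=> FG sa [Fx Fy]; have [nx ny] := separated_slices m sa; split.
- by apply: near_eq_is_cderive Fx; apply: filterS nx => x; exact: FG.
- by apply: near_eq_is_cderive Fy; apply: filterS ny => y; exact: FG.
Qed.

(* For real [f] the antiholomorphic derivative is the conjugate of the
   holomorphic one, so that a single [p] records both. *)
Definition has_logderiv m f a p : Prop :=
  has_wirtinger m (fun b => (f b)%:C) a ((f a)%:C * p) ((f a)%:C * p^*%C).

Lemma has_logderivM m f g a p q : has_logderiv m f a p -> has_logderiv m g a q ->
  has_logderiv m (fun b => f b * g b) a (p + q).
Proof.
move=> fp gq; have := has_wirtingerM fp gq.
under eq_fun do rewrite -realcM.
by move/has_wirtinger_eq; apply; rewrite realcM ?conjcD; ring.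
Qed.

Lemma has_logderiv_prod m (I : Type) (r : seq I) (P : pred I) (f : I -> ('I_n -> R[i]) -> R)
    a (p : I -> R[i]) :
  (forall j, P j -> has_logderiv m (f j) a (p j)) ->
  has_logderiv m (fun b => \prod_(j <- r | P j) f j b) a (\sum_(j <- r | P j) p j).
Proof.
move=> fP; elim: r => [|j r IHr].
  rewrite big_nil /has_logderiv conjc0 !mulr0.
  by under eq_fun do rewrite big_nil; exact: has_wirtinger_cst.
rewrite big_cons; case: ifPn => Pj.
  rewrite (_ : (fun b => _) = (fun b => f j b * \prod_(j <- r | P j) f j b)).
    exact/has_logderivM/IHr/fP.
  by apply/funext => b; rewrite big_cons Pj.
rewrite (_ : (fun b => _) = (fun b => \prod_(j <- r | P j) f j b)) //.
by apply/funext => b; rewrite big_cons (negbTE Pj).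
Qed.

Lemma has_logderiv_powR m f a p e : 0 < f a -> has_logderiv m f a p ->
  has_logderiv m (fun b => f b `^ e) a (e%:C * p).
Proof.
move=> fa0 /(has_wirtinger_powR e fa0) H.
have E : f a `^ e = f a `^ (e - 1) * f a.
  rewrite -[X in _ * X]powRr1 1?ltW // -powRD ?subrK //.
  by rewrite (gt_eqF fa0) implybT.
apply: (has_wirtinger_eq H); rewrite E !realcM; first by ring.
by rewrite conjcM conjc_real; ring.
Qed.

(** Differentiate [Im z = (z - conj z) / (2 i)]. *)
Lemma has_logderiv_Im m k a : separated a ->
  has_logderiv m (fun b => complex.Im (b k)) a ((k == m)%:R / (a k - (a k)^*%C)).
Proof.
move=> [a0 _].
have i0 : 'i%C != 0 :> R[i] by rewrite eq_complex /= oner_eq0 andbF.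
have ImE (z : R[i]) : (complex.Im z)%:C = (z - z^*%C) * (2 * 'i%C)^-1.
  rewrite subcJ; field; exact: i0.
have d0 : a k - (a k)^*%C != 0.
  have := a0 k; apply: contraTneq => E; have := ImE (a k); rewrite E mul0r => -[->].
  by rewrite ltxx.
have co := has_wirtinger_coord m k a.
have /(has_wirtingerM (has_wirtingerD co (has_wirtingerM (has_wirtinger_cst m (-1) a)
  (has_wirtinger_conj co)))) := has_wirtinger_cst m (2 * 'i%C)^-1 a.
rewrite (_ : (fun b => _) = (fun b => (complex.Im (b k))%:C)); last first.
  by apply/funext => b; rewrite ImE mulN1r.
move=> H; rewrite /has_logderiv.
have E := has_wirtinger_real H.
rewrite (_ : (complex.Im (a k))%:C * _^*%C = ((complex.Im (a k))%:C * ((k == m)%:R / (a k - (a k)^*%C)))^*%C); last first.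
  by rewrite [in RHS]conjcM conjc_real.
rewrite (_ : (complex.Im (a k))%:C * _ = (k == m)%:R / (2 * 'i%C)); last first.
  rewrite ImE; field; by rewrite d0 i0.
apply: (has_wirtinger_eq H); first by rewrite conjc0; ring.
rewrite E; congr (_^*%C); rewrite conjc0; ring.
Qed.

(** Use [|F|^2 = F * conj F], whose second factor has holomorphic logarithmic derivative [conj q];
    the square root halves the sum. *)
Lemma has_logderiv_normc m F a p q : F a != 0 -> has_wirtinger m F a (F a * p) (F a * q) ->
  has_logderiv m (fun b => Normc.normc (F b)) a (2^-1 * (p + q^*%C)).
Proof.
move=> Fa0 H.
have H2 : has_logderiv m (fun b => Normc.normc (F b) ^+ 2) a (p + q^*%C).
  have E b : (Normc.normc (F b) ^+ 2)%:C = F b * (F b)^*%C by rewrite -sqr_normc rmorphXn.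
  rewrite /has_logderiv E; under eq_fun do rewrite E.
  apply: (has_wirtinger_eq (has_wirtingerM H (has_wirtinger_conj H))).
    by rewrite conjcM; ring.
  by rewrite conjcM conjcD conjcK; ring.
have F0 b : 0 <= Normc.normc (F b) by rewrite /Normc.normc; case: (F b) => x y; exact: sqrtr_ge0.
have Fa : 0 < Normc.normc (F a) ^+ 2.
  rewrite exprn_gt0 // lt0r F0 andbT; apply: contraNneq Fa0 => /Normc.eq0_normc ->.
  exact: eqxx.
have := has_logderiv_powR 2^-1 Fa H2.
rewrite (_ : (fun b => _) = (fun b => Normc.normc (F b))).
  by rewrite fmorphV rmorph_nat.
by apply/funext => b; rewrite powR12_sqrt ?sqr_ge0 // sqrtr_sqr ger0_norm.
Qed.

End HasWirtinger.

(** * Spin correlations *)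

(** Each [l != m] forms exactly one ordered pair with [m]. This serves both for products of weights
    and for sums of derivatives. *)
Lemma big_pairs_at (S : Type) (idx : S) (op : Monoid.com_law idx) (n : nat) (m : 'I_n)
    (u : 'I_n -> S) :
  \big[op/idx]_(k < n) \big[op/idx]_(l < n | (k < l)%N)
    (if k == m then u l else if l == m then u k else idx) =
  \big[op/idx]_(l | l != m) u l.
Proof.
rewrite (bigD1 m) //= [RHS](bigID (fun l : 'I_n => (m < l)%N)) /=; congr (op _ _).
  apply: eq_big => [l|l _]; last by rewrite eqxx.
  by rewrite -(inj_eq val_inj) /=; case: ltngtP.
rewrite [RHS]big_mkcondr; apply: eq_bigr => k km.
rewrite -leqNgt leq_eqVlt (inj_eq val_inj) (negbTE km) /=.
case: ifPn => [ltkm|]; last first.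
  move=> kNm; rewrite big1 // => l kl; case: eqP => // lm.
  by rewrite -lm kl in kNm.
rewrite (bigD1 m) //= eqxx big1 ?Monoid.mulm1 // => l /andP[_ /negbTE ->].
by [].
Qed.

Section SpinCorrelation.
Variables (R : realType) (n : nat).
Implicit Types (a b : 'I_n -> R[i]) (s t : {ffun 'I_n -> bool}) (m k l : 'I_n).

Definition ratio b k l : R := Normc.normc ((b k - b l) / (b k - (b l)^*%C)).

(** The exponent is [- 4^-1], twice that of [spin_correlation], because the prefactor is moved under
    the square root. *)
Definition spin_term s b : R :=
  (\prod_k complex.Im (b k) `^ (- 4^-1)) *
  \prod_(k < n) \prod_(l < n | (k < l)%N) ratio b k l `^ (spin (s k) * spin (s l) / 2).

(* Mirror images turn the antiholomorphic variables into further charged points. *)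
Definition doubled b k (c : bool) : R[i] := if c then (b k)^*%C else b k.

Lemma spin_correlationE b : spin_correlation b = (\sum_s spin_term s b) `^ 2^-1.
Proof.
rewrite /spin_correlation /spin_term -mulr_sumr powRM; last first.
- by apply: sumr_ge0 => s _; do 2! apply: prodr_ge0 => ? _; exact: powR_ge0.
- by apply: prodr_ge0 => ? _; exact: powR_ge0.
congr (_ * _).
have pow_prod (f : 'I_n -> R) e : (forall k, 0 <= f k) ->
    (\prod_k f k) `^ e = \prod_k f k `^ e.
  move=> f0; suff [] : (\prod_k f k) `^ e = \prod_k f k `^ e /\ 0 <= \prod_k f k by [].
  apply: (big_ind2 (fun x y => x `^ e = y /\ 0 <= x)).
  - by rewrite powR1.
  - by move=> x1 x2 y1 y2 [<- x1p] [<- y1p]; rewrite powRM // mulr_ge0.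
  - by move=> k _; split.
rewrite pow_prod; last by move=> k; exact: powR_ge0.
by apply: eq_bigr => k _; rewrite -powRrM; congr (_ `^ _); field.
Qed.

Lemma separated_doubled b : separated b ->
  forall k l c d, doubled b k c = doubled b l d -> k = l /\ c = d.
Proof.
move=> [b0 binj] k l c d.
have H k' l' : b k' != (b l')^*%C.
  apply/eqP => /(congr1 (@complex.Im R)) /=.
  by case: (b k') (b l') (b0 k') (b0 l') => x y [x' y'] /= y0 y'0; lra.
case: c d => -[] /=.
- by move/(inv_inj (@conjcK R))/binj => ->.
- by move/esym/eqP; rewrite (negbTE (H _ _)).
- by move/eqP; rewrite (negbTE (H _ _)).
- by move/binj => ->.
Qed.

Lemma doubledB_neq0 b k l c d : separated b -> (k, c) != (l, d) ->
  doubled b k c - doubled b l d != 0.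
Proof.
move=> sb; apply: contraNneq => /eqP; rewrite subr_eq0 => /eqP.
by move/(separated_doubled sb) => [-> ->].
Qed.

Lemma ratio_gt0 b k l : separated b -> k != l -> 0 < ratio b k l.
Proof.
move=> sb kl; rewrite /ratio lt0r.
have -> /= : 0 <= Normc.normc ((b k - b l) / (b k - (b l)^*%C)).
  by case: (_ / _) => x y; exact: sqrtr_ge0.
rewrite andbT; apply/eqP => /Normc.eq0_normc/eqP; rewrite mulf_eq0 invr_eq0.
have := @doubledB_neq0 b k l false false sb; rewrite xpair_eqE (negbTE kl) => /(_ isT)/negbTE /= ->.
have := @doubledB_neq0 b k l false true sb; rewrite xpair_eqE (negbTE kl) => /(_ isT)/negbTE /= ->.
by [].
Qed.

Lemma ratioC b k l : ratio b k l = ratio b l k.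
Proof.
have nV (x : R[i]) : Normc.normc x^-1 = (Normc.normc x)^-1 by exact: Normc.normcV.
rewrite /ratio !Normc.normcM !nV; congr (_ / _).
  by case: (b k) (b l) => x y [x' y'] /=; congr Num.sqrt; ring.
by case: (b k) (b l) => x y [x' y'] /=; congr Num.sqrt; ring.
Qed.

Lemma ratio_sqr b k l : separated b -> k != l ->
  (ratio b k l ^+ 2)%:C = (cross (doubled b) k l)^-1.
Proof.
move=> sb kl.
have -> : (ratio b k l ^+ 2)%:C = ((b k - b l) / (b k - (b l)^*%C)) * ((b k - b l) / (b k - (b l)^*%C))^*%C.
  by rewrite -sqr_normc rmorphXn.
rewrite conjcM conjc_inv /cross /doubled.
rewrite !conjcB conjcK invf_div; have N := doubledB_neq0 sb.
have kl2 (c d : bool) : (k, c) != (l, d) by rewrite xpair_eqE (negbTE kl).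
have := N _ _ _ _ (kl2 false true); have := N _ _ _ _ (kl2 true false) => /= N1 N2.
by field; rewrite N1 N2.
Qed.

Lemma spin_term_gt0 s b : separated b -> 0 < spin_term s b.
Proof.
move=> sb; rewrite mulr_gt0 //; apply: prodr_gt0 => k _.
  by apply: powR_gt0; case: sb.
apply: prodr_gt0 => l kl; apply: powR_gt0; apply: ratio_gt0 => //.
by rewrite -(inj_eq val_inj) /= neq_ltn kl.
Qed.

(** Only pairs containing [k] are affected: their exponent changes sign, hence drops by twice its
    value. *)
Lemma spin_term_flip k s b : separated b ->
  spin_term (flip k s) b =
  spin_term s b * \prod_(l | l != k) ratio b k l `^ (- (spin (s k) * spin (s l))).
Proof.
move=> sb; rewrite /spin_term -mulrA; congr (_ * _).
rewrite -big_pairs_at -big_split; apply: eq_bigr => j _.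
rewrite -big_split; apply: eq_bigr => l jl /=.
have jl' : j != l by rewrite -(inj_eq val_inj) /= neq_ltn jl.
have r0 : ratio b j l != 0 by rewrite gt_eqF // ratio_gt0.
have spinN c : spin (~~ c) = - spin c :> R by rewrite /spin; case: c; rewrite ?expr0 ?expr1 ?opprK.
rewrite !ffunE; case: (eqVneq j k) => [jk|jk].
  rewrite -jk [l == j]eq_sym (negbTE jl') addbF addbT spinN -powRD ?r0 ?implybT //.
  by congr (_ `^ _); field.
case: (eqVneq l k) => [lk|lk]; last by rewrite !addbF mulr1.
rewrite addbF addbT spinN -lk [ratio b l j]ratioC -powRD ?r0 ?implybT //.
by congr (_ `^ _); field.
Qed.

(** The exponents of [ratio b k l] add up to 0 or to plus or minus 2, and [ratio_sqr] turns the
    latter into cross-ratios. *)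
Lemma spin_term_flip2 b s t k : separated b ->
  (spin_term (flip k s) b)%:C * (spin_term (flip k t) b)%:C =
  (spin_term s b)%:C * (spin_term t b)%:C *
  \prod_(l | (l != k) && (s k (+) s l == t k (+) t l))
    (if s k == s l then cross (doubled b) k l else (cross (doubled b) k l)^-1).
Proof.
move=> sb; rewrite !spin_term_flip // (realcM (spin_term s b)) (realcM (spin_term t b)) -!mulrA; congr (_ * _).
rewrite mulrCA; congr (_ * _).
have prodC (f : 'I_n -> R) : (\prod_(l | l != k) f l)%:C = \prod_(l | l != k) (f l)%:C.
  exact: rmorph_prod.
rewrite !prodC -big_split [RHS]big_mkcondr; apply: eq_bigr => l lk /=.
have kl : k != l by rewrite eq_sym.
have r0 := ratio_gt0 sb kl.
rewrite -realcM -powRD; last by rewrite (gt_eqF r0) implybT.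
have r2 := ratio_sqr sb kl.
have E2 : (ratio b k l `^ (- 2))%:C = cross (doubled b) k l.
  by rewrite powR_invn ?(ltW r0) // realcV r2 invrK.
have E2' : (ratio b k l `^ 2)%:C = (cross (doubled b) k l)^-1.
  by rewrite powR_mulrn ?(ltW r0) // r2.
rewrite -E2' -E2 /spin.
have E0 : 1 = (ratio b k l `^ 0)%:C by rewrite powRr0.
by case: (s k) (s l) (t k) (t l) => [] [] [] [] /=; rewrite ?expr1 ?expr0 ?[RHS]E0;
  congr ((_ `^ _)%:C); ring.
Qed.

Lemma has_logderiv_ratio m k l a : separated a -> k != l ->
  has_logderiv m (fun b => ratio b k l) a
    (2^-1 * (if k == m then (a m - a l)^-1 - (a m - (a l)^*%C)^-1
             else if l == m then (a m - a k)^-1 - (a m - (a k)^*%C)^-1 else 0)).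
Proof.
move=> sa kl.
have Nd := doubledB_neq0 sa.
have kl2 (c d : bool) : (k, c) != (l, d) by rewrite xpair_eqE (negbTE kl).
have N1 : a k - a l != 0 := Nd _ _ _ _ (kl2 false false).
have N2 : a k - (a l)^*%C != 0 := Nd _ _ _ _ (kl2 false true).
have N1' : a l - a k != 0 by rewrite -opprB oppr_eq0.
have N2' : (a k)^*%C - a l != 0 := Nd _ _ _ _ (kl2 true false).
have Hk := has_wirtinger_coord m k a.
have Hl := has_wirtinger_coord m l a.
have HN F p q : has_wirtinger m F a p q -> has_wirtinger m (fun b => - F b) a (- p) (- q).
  move=> HF; have := has_wirtingerM (has_wirtinger_cst m (-1) a) HF.
  under eq_fun do rewrite mulN1r.
  by move/has_wirtinger_eq; apply; ring.
have H1 := has_wirtingerD Hk (HN _ _ _ Hl).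
have H2 := has_wirtingerV N2 (has_wirtingerD Hk (HN _ _ _ (has_wirtinger_conj Hl))).
have H := has_wirtingerM H1 H2.
(* [p] and [q] are the logarithmic derivatives of the complex quotient; [conj (b l)] contributes to
   [q] only. *)
pose p : R[i] := ((k == m)%:R - (l == m)%:R) / (a k - a l) - (k == m)%:R / (a k - (a l)^*%C).
pose q : R[i] := (l == m)%:R / (a k - (a l)^*%C).
have Fa0 : (a k - a l) / (a k - (a l)^*%C) != 0 by rewrite mulf_neq0 ?invr_neq0.
have H' : has_wirtinger m (fun b => (b k - b l) / (b k - (b l)^*%C)) a
    ((a k - a l) / (a k - (a l)^*%C) * p) ((a k - a l) / (a k - (a l)^*%C) * q).
  apply: (has_wirtinger_eq H); rewrite /p /q ?conjc0 ?conjc_nat; field; by rewrite ?N1 ?N2.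
rewrite [X in has_logderiv _ _ _ (_ * X)](_ : _ = p + q^*%C).
  exact: has_logderiv_normc H'.
rewrite /p /q conjcM conjc_nat conjc_inv conjcB conjcK.
case: (eqVneq k m) => [km|km].
  by rewrite -km [l == k]eq_sym (negbTE kl) /=; field; rewrite ?N1 ?N2 ?N2'.
case: (eqVneq l m) => [<-|lm]; last by rewrite subrr !mul0r subrr addr0.
have N3 : a l - (a k)^*%C != 0 by rewrite -opprB oppr_eq0.
by rewrite /=; field; rewrite ?N1 ?N1' ?N2 ?N3 ?N2'.
Qed.

(** The ratios give the interaction of [a m] with the other points and their images, and the power
    of [Im (a m)] gives that with its own image. *)
Lemma has_logderiv_spin_term s m a : separated a ->
  has_logderiv m (spin_term s) a (4^-1 * coulomb (doubled a) 1 s (m, false)).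
Proof.
move=> sa.
have HI := has_logderiv_prod (index_enum 'I_n) (P := predT) (fun k _ =>
  has_logderiv_powR (- 4^-1) (proj1 sa k) (has_logderiv_Im m k sa)).
have HR := has_logderiv_prod (index_enum 'I_n) (P := predT) (fun k _ =>
  has_logderiv_prod (index_enum 'I_n) (P := fun l : 'I_n => (k < l)%N) (fun l kl =>
  has_logderiv_powR (spin (s k) * spin (s l) / 2) (ratio_gt0 sa (negbT (ltn_eqF kl)))
    (has_logderiv_ratio m sa (negbT (ltn_eqF kl))))).
have := has_logderivM HI HR.
congr (has_logderiv m _ a _).
have sgE (c : bool) : (spin c : R)%:C = (-1) ^+ c by exact: rmorph_sign.
have invC : ((2^-1 : R)%:C = 2^-1) /\ ((4^-1 : R)%:C = 4^-1).
  by rewrite !realcV !rmorph_nat.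
pose u l : R[i] := 4^-1 * ((-1) ^+ s m * (-1) ^+ s l * ((a m - a l)^-1 - (a m - (a l)^*%C)^-1)).
have -> : \sum_(j < n) \sum_(l < n | (j < l)%N) (spin (s j) * spin (s l) / 2)%:C *
    (2^-1 * (if j == m then (a m - a l)^-1 - (a m - (a l)^*%C)^-1
             else if l == m then (a m - a j)^-1 - (a m - (a j)^*%C)^-1 else 0)) =
    \sum_(l | l != m) u l.
  rewrite -big_pairs_at; apply: eq_bigr => j _; apply: eq_bigr => l _.
  have E (x y z : R[i]) : x * y * 2^-1 * (2^-1 * z) = 4^-1 * (x * y * z) by field.
  rewrite !realcM !sgE (proj1 invC) E /u; case: (eqVneq j m) => [->//|_].
  by case: (eqVneq l m) => [->|_]; [rewrite [(-1) ^+ s j * _]mulrC|rewrite !mulr0].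
rewrite (bigD1 m) //= eqxx big1 => [|k /negbTE ->]; last by rewrite mul0r mulr0.
(* In [u m] the term [(a m - a m)^-1] is 0, and only the mirror image remains. *)
rewrite addr0 (_ : (- 4^-1)%:C * _ = u m).
  transitivity (\sum_l u l); first by rewrite [RHS](bigD1 m).
  rewrite /u -mulr_sumr; congr (_ * _).
  rewrite /coulomb -(pair_bigA _ (fun k c => charge R[i] s (m, false) * charge R[i] s (k, c) /
    (doubled a m false - doubled a k c) ^+ 1)) /=.
  apply: eq_bigr => k _; rewrite big_bool /= !expr1 /charge /= !addbF addbT signrN.
  ring.
have -> : (- 4^-1)%:C = - 4^-1 :> R[i].
  by rewrite -(proj2 invC); exact: rmorphN.
by rewrite /u subrr invr0 -expr2 sqrr_sign mulr1n; ring.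
Qed.

(** Conjugation swaps points with images and reverses all charges, which preserves products of two
    charges. *)
Lemma coulomb_conj n0 s m a :
  coulomb (doubled a) n0 s (m, true) = (coulomb (doubled a) n0 s (m, false))^*%C.
Proof.
rewrite /coulomb conjc_sum.
rewrite (reindex_inj (h := fun r : 'I_n * bool => (r.1, ~~ r.2))) /=; last first.
  by move=> [k c] [l d] [-> /negb_inj ->].
apply: eq_bigr => -[k c] _ /=.
have cX (x : R[i]) : (x ^+ n0)^*%C = x^*%C ^+ n0 by exact: rmorphXn.
have c1 (c' : bool) : ((-1) ^+ c')^*%C = (-1) ^+ c' :> R[i] by exact: rmorph_sign.
rewrite conjcM conjc_inv cX conjcB conjcM /charge /= !c1.
congr (_ / _ ^+ _); first by case: (s m) (s k) c => [] [] [] /=; ring.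
by case: c => /=; rewrite ?conjcK.
Qed.

(** The value of [p] feeds [d_ i (d_ i F)]; the existence of [q] ensures that both partials
    exist. *)
Lemma has_wirtinger_coulomb s m a : separated a -> exists q,
  has_wirtinger m (fun b => coulomb (doubled b) 1 s (m, false)) a
    (- coulomb (doubled a) 2 s (m, false)) q.
Proof.
move=> sa.
suff H r : exists q, has_wirtinger m (fun b => charge R[i] s (m, false) * charge R[i] s r
      / (doubled b m false - doubled b r.1 r.2) ^+ 1) a
    (- (charge R[i] s (m, false) * charge R[i] s r
      / (doubled a m false - doubled a r.1 r.2) ^+ 2)) q.
  have [q Hq] := choice H; exists (\sum_r q r).
  by rewrite /coulomb -sumrN; apply: has_wirtinger_sum => r _; exact: Hq.
set c := _ * _; have [->|rm] := eqVneq r (m, false).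
  exists 0; rewrite subrr expr0n invr0 mulr0 oppr0.
  by under eq_fun do rewrite subrr expr0n invr0 mulr0; exact: has_wirtinger_cst.
have Nd : doubled a m false - doubled a r.1 r.2 != 0.
  by rewrite doubledB_neq0 // eq_sym -surjective_pairing.
(* The other doubled points have another index or are conjugated, so they do not depend
   holomorphically on [b m]. *)
have [p' [q' [Hr p'0]]] : exists p' q', has_wirtinger m (fun b => doubled b r.1 r.2) a p' q' /\ p' = 0.
  case: r rm {Nd c} => k [] /= rm.
    have := has_wirtinger_conj (has_wirtinger_coord m k a); rewrite conjc0 => H.
    by do 2! eexists; split; first exact: H.
  have := has_wirtinger_coord m k a; rewrite (_ : (k == m) = false) => [H|].
    by do 2! eexists; split; first exact: H.
  by apply: contraNF rm => /eqP ->.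
have H1 := has_wirtinger_coord m m a; rewrite eqxx in H1.
have H2 := has_wirtingerD H1 (has_wirtingerM (has_wirtinger_cst m (-1) a) Hr).
have Nd' : doubled a m false + -1 * doubled a r.1 r.2 != 0 by rewrite mulN1r.
have H3 := has_wirtingerM (has_wirtinger_cst m c a) (has_wirtingerV Nd' H2).
eexists; under eq_fun do rewrite expr1 -mulN1r.
apply: (has_wirtinger_eq H3); last by [].
by rewrite p'0 -[doubled a m false]/(a m) !mul0r mulr0 !addr0 add0r !mulN1r; ring.
Qed.

End SpinCorrelation.

(** * The BPZ equation for the spin correlation *)

Theorem corollary1p2 (R : realType) (n : nat) (hn : (1 <= n)%N)
    (a : 'I_n -> R[i])
    (a_upper : forall k : 'I_n, 0 < complex.Im (a k))
    (a_distinct : injective a)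
    (i : 'I_n) :
  bpz_annihilates i
    (fun b : 'I_n -> R[i] => (spin_correlation b)%:C) a.
Proof.
have sa : separated a by [].
pose T (b : 'I_n -> R[i]) (s : {ffun 'I_n -> bool}) := (spin_term s b)%:C.
pose W (b : 'I_n -> R[i]) := \sum_s spin_term s b.
pose F (b : 'I_n -> R[i]) := (spin_correlation b)%:C.
(* The logarithmic derivatives of [F] in the doubled variables; the 2 in the denominator comes from
   the square root of [W]. *)
pose L (b : 'I_n -> R[i]) (p : 'I_n * bool) := (\sum_s T b s * (4^-1 * coulomb (doubled b) 1 s p)) / (2 * \sum_s T b s).
have WE b : (W b)%:C = \sum_s T b s by exact: rmorph_sum.
have W0 b : separated b -> 0 < W b.
  move=> sb; rewrite /W (bigD1 [ffun=> false]) //= ltr_pwDl ?spin_term_gt0 //.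
  by apply: sumr_ge0 => s _; exact/ltW/spin_term_gt0.
have WC0 b : separated b -> \sum_s T b s != 0.
  move=> sb; rewrite -WE; apply/eqP => -[E].
  by have := W0 b sb; rewrite E ltxx.
have Lconj b m : L b (m, true) = (L b (m, false))^*%C.
  have c_nat k : (k%:R : R[i])^*%C = k%:R by exact: conjc_nat.
  rewrite /L -WE conjcM conjc_inv conjcM conjc_real c_nat conjc_sum; congr (_ / _).
  apply: eq_bigr => s _; rewrite conjcM conjcM conjc_inv c_nat coulomb_conj.
  by rewrite conjc_real.
have DF b m : separated b -> has_wirtinger m F b (F b * L b (m, false)) (F b * L b (m, true)).
  move=> sb.
  have HW : has_logderiv m W b (2 * L b (m, false)).
    have := has_wirtinger_sum (index_enum _) (P := predT)
      (fun s _ => has_logderiv_spin_term s m sb).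
    rewrite /has_logderiv.
    rewrite (_ : (fun b => \sum_(s | predT s) _) = (fun b => (W b)%:C)); last first.
      by apply/funext => c; rewrite WE.
    move=> H; have E := has_wirtinger_real H.
    have E1 : (W b)%:C * (2 * L b (m, false)) = \sum_s T b s * (4^-1 * coulomb (doubled b) 1 s (m, false)).
      rewrite /L WE; field; exact: WC0.
    apply: (has_wirtinger_eq H); first by rewrite E1.
    by rewrite -[(W b)%:C in RHS]conjc_real -conjcM E1 -E.
  have := has_logderiv_powR 2^-1 (W0 b sb) HW.
  rewrite /has_logderiv (_ : (fun b => (W b `^ 2^-1)%:C) = F); last first.
    by apply/funext => c; rewrite /F spin_correlationE.
  have -> : (2^-1 : R)%:C * (2 * L b (m, false)) = L b (m, false).
    by rewrite realcV rmorph_nat mulKf // pnatr_eq0.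
  by rewrite -spin_correlationE Lconj.
(* Differentiating [F * L] gives [F * (L ^+ 2 + L')], with [L'] from the quotient rule in the form
   required by [bpz_algebra]. *)
have [q DDF] : exists q, has_wirtinger i (d_ i F) a (F a * (L a (i, false) ^+ 2 +
    ((\sum_s T a s * ((4^-1 * coulomb (doubled a) 1 s (i, false)) ^+ 2
        - 4^-1 * coulomb (doubled a) 2 s (i, false))) / (2 * \sum_s T a s)
     - (\sum_s T a s * (4^-1 * coulomb (doubled a) 1 s (i, false))) ^+ 2
       / (2 * (\sum_s T a s) ^+ 2)))) q.
  have HT s : exists q, has_wirtinger i
      (fun b => T b s * (4^-1 * coulomb (doubled b) 1 s (i, false))) a
      (T a s * ((4^-1 * coulomb (doubled a) 1 s (i, false)) ^+ 2
        - 4^-1 * coulomb (doubled a) 2 s (i, false))) q.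
    have [q Hq] := has_wirtinger_coulomb s i sa.
    have := has_wirtingerM (has_logderiv_spin_term s i sa)
      (has_wirtingerM (has_wirtinger_cst i 4^-1 a) Hq).
    by move/has_wirtinger_eq => H; eexists; apply: H; [rewrite /T; ring|by []].
  have [q Hq] := choice HT.
  have HN := has_wirtinger_sum (index_enum _) (P := predT) (fun s _ => Hq s).
  have HW := has_wirtinger_sum (index_enum _) (P := predT)
      (fun s _ => has_logderiv_spin_term s i sa).
  have two_neq0 : 2 * \sum_s T a s != 0 by rewrite mulf_neq0 ?pnatr_eq0 ?WC0.
  have H2W := has_wirtingerV two_neq0 (has_wirtingerM (has_wirtinger_cst i 2 a) HW).
  have H := has_wirtingerM (DF a i sa) (has_wirtingerM HN H2W).
  eexists; apply: (has_wirtinger_separated _ sa); last first.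
    apply: (has_wirtinger_eq H); last by [].
    have alg (f N V D : R[i]) : V != 0 ->
        f * (N / (2 * V)) * (N / (2 * V))
          + f * (D / (2 * V) + N * (- (0 * V + 2 * N) / (2 * V) ^+ 2)) =
        f * ((N / (2 * V)) ^+ 2 + (D / (2 * V) - N ^+ 2 / (2 * V ^+ 2))).
      by move=> V0; field.
    exact: alg (WC0 a sa).
  by move=> b sb /=; have [_ -> _] := has_wirtingerE (DF b i sb).
split.
- by move=> j; have [] := has_wirtingerE (DF a j sa).
- by have [] := has_wirtingerE DDF.
have dF j : d_ j F a = F a * L a (j, false) by have [] := has_wirtingerE (DF a j sa).
have dbF j : dbar_ j F a = F a * L a (j, true) by have [] := has_wirtingerE (DF a j sa).
rewrite /bpz_operator; have [_ -> _] := has_wirtingerE DDF.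
have := bpz_algebra i (separated_doubled sa) (fun s t k => spin_term_flip2 s t k sa) (WC0 a sa).
(* The sum over doubled points other than [(i, false)] splits into the points [j != i] and all
   mirror images. *)
rewrite !sum_pair_neq /=; set D := (_ / _ - _ / _) => E.
have {}E : 8 / 3 * (L a (i, false) ^+ 2 + D) +
    (\sum_(j < n | j != i) 2 / (a j - a i) * L a (j, false)
     + \sum_(j < n) 2 / ((a j)^*%C - a i) * L a (j, true))
    - (\sum_(j < n | j != i) 8^-1 / (a j - a i) ^+ 2
       + \sum_(j < n) 8^-1 / ((a j)^*%C - a i) ^+ 2) = 0 := E.
have -> : \sum_(j < n | j != i) 2 / (a j - a i) * d_ j F a =
    F a * \sum_(j < n | j != i) 2 / (a j - a i) * L a (j, false).
  by rewrite mulr_sumr; apply: eq_bigr => j _; rewrite dF mulrCA.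
have -> : \sum_(j < n) 2 / ((a j)^*%C - a i) * dbar_ j F a =
    F a * \sum_(j < n) 2 / ((a j)^*%C - a i) * L a (j, true).
  by rewrite mulr_sumr; apply: eq_bigr => j _; rewrite dbF mulrCA.
by rewrite -[RHS](mulr0 (F a)) -[in RHS]E -/(F a) -/D; ring.
Qed.
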